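(* Let $d, k, i$ be positive integers with $1 \leq i < k$ and $d> \binom{k}{i+1}$. Let $H$ be any $k$-uniform hypergraph with $d_i(H) \geq d$. Then $\mathrm{ex}(n,H)\geq \Omega_k\left( n^{k- 3^k / d}\right)$.
   Context: For a $k$-uniform hypergraph $H$ and $0\le i<k$, the $i$-skeleton $H^{(i)}$ is the $(i+1)$-uniform hypergraph on $V(H)$ whose edges are all $(i+1)$-sets contained in some edge of $H$; the $i$-th skeletal degeneracy $d_i(H)$ is the least $d$ such that every subhypergraph of $H^{(i)}$ has minimum degree at most $d$. $\mathrm{ex}(n,H)$ is the maximum number of edges in an $n$-vertex $k$-uniform hypergraph with no copy of $H$. $\Omega_k(f(n))$ denotes a quantity at least $cf(n)$ for a constant $c>0$ depending only on $k$ (for all sufficiently large $n$). *)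

(* Defs.v *)
From mathcomp Require Import all_boot.

Set Implicit Arguments.
Unset Strict Implicit.
Unset Printing Implicit Defensive.

(* A hypergraph is given by its edge set [H : {set {set V}}]; its vertex set is
   the whole finite type [V], so isolated vertices are allowed. *)
Section Hypergraph.
Variable V : finType.
Implicit Types (H F : {set {set V}}) (W : {set V}).

Definition uniform (k : nat) H : bool := [forall e in H, #|e| == k].

Definition skeleton (i : nat) H : {set {set V}} :=
  [set S : {set V} | (#|S| == i.+1) && [exists e in H, S \subset e]].

Definition degree F (v : V) : nat := #|[set e in F | v \in e]|.

(* [W] and [F] are the vertex and edge sets of a (not necessarily induced or
   spanning) subhypergraph. *)
Definition subhypergraph W F H : bool :=
  (F \subset H) && [forall e in F, e \subset W].

(* The initial value #|F| bounds every degree, so it only matters for empty W;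
   a subhypergraph of a skeleton on no vertices has no edges, hence minimum
   degree 0. *)
Definition min_degree W F : nat := \big[minn/#|F|]_(v in W) degree F v.

Definition degeneracy_le H (d : nat) : bool :=
  [forall W : {set V}, [forall F : {set {set V}},
     subhypergraph W F H ==> (min_degree W F <= d)]].

Lemma degeneracy_le_exists H : exists d, degeneracy_le H d.
Proof.
exists #|H|; apply/forallP => W; apply/forallP => F; apply/implyP.
case/andP=> /subset_leq_card sFH _; apply: leq_trans sFH.
rewrite /min_degree; elim/big_rec: _ => // v x _ lex.
by rewrite geq_min lex orbT.
Qed.

Definition skeletal_degeneracy (i : nat) H : nat :=
  ex_minn (degeneracy_le_exists (skeleton i H)).

End Hypergraph.

Definition contains_copy (V T : finType) (H : {set {set V}})
    (G : {set {set T}}) : bool :=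
  [exists f : {ffun V -> T}, injectiveb f && [forall e in H, f @: e \in G]].

Definition ex (k n : nat) (V : finType) (H : {set {set V}}) : nat :=
  \max_(G : {set {set 'I_n}} | uniform k G && ~~ contains_copy H G) #|G|.

(* Main.v *)
(** Let F be a subhypergraph of the i-skeleton of H with minimum degree at
    least d, on the vertex set W; since d > C(k, i+1), W has more than k
    vertices.  Let A be a random set of (i+1)-subsets of the n vertices, each
    kept with probability p = (q/n)^((i+1)/d), where q depends only on k, and
    let G consist of the k-sets K all of whose (i+1)-subsets are in A: a copy
    of H in G yields a copy of F in A.  Given such a K, an embedding g of F has
    at least d u / (i+1) edges not contained in K, where u is the number of
    vertices that g maps outside of K.  Hence g(F) is contained in A with
    probability at most (q/n)^u, and as at most k < |W| vertices are mapped into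
    K these probabilities add up to at most 1/2.  The expected number of edges
    of G, counted only when A contains no copy of F, is therefore at least
    C(n, k) p^C(k, i+1) / 2, and (i+1) C(k, i+1) <= 3^k. *)
Require Import Defs.
From mathcomp Require Import all_boot all_order all_algebra.
From mathcomp Require Import zify ring lra.
From mathcomp Require Import reals exp.

Set Implicit Arguments.
Unset Strict Implicit.
Unset Printing Implicit Defensive.

Import Order.TTheory GRing.Theory Num.Theory.
Local Open Scope ring_scope.

(** * Random subsets with independent elements *)

Definition subset_weight (R : pzRingType) (T : finType) (p : R) (A : {set T}) :=
  \prod_x (if x \in A then p else 1 - p).

(** The probability that a [p]-random set contains [S]: expand a product whose factor is [p] on [S]
    and [p + (1 - p) = 1] elsewhere. *)
Lemma sum_subset_weight (R : comPzRingType) (T : finType) (p : R)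
    (S : {set T}) :
  \sum_(A : {set T}) subset_weight p A * (S \subset A)%:R = p ^+ #|S|.
Proof.
transitivity (\prod_x (p + (if x \in S then 0 else 1 - p))).
  rewrite bigA_distr; apply: eq_bigr => A _.
  have [/subsetP sSA | /subsetPn[x xS xA]] := boolP (S \subset A).
    rewrite mulr1; apply: eq_bigr => x _.
    by case: ifP => // xA; case: ifP => // /sSA; rewrite xA.
  by rewrite mulr0 (bigD1 x) //= (negPf xA) xS mul0r.
rewrite (bigID (mem S)) /= [X in _ * X]big1 ?mulr1.
  by rewrite -prodr_const; apply: eq_bigr => x ->; rewrite addr0.
by move=> x /negPf ->; rewrite subrKC.
Qed.

Lemma subset_weight_ge0 (R : numDomainType) (T : finType) (p : R)
    (A : {set T}) : 0 <= p <= 1 -> 0 <= subset_weight p A.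
Proof.
by case/andP=> ? ?; apply: prodr_ge0 => x _; case: ifP; rewrite ?subr_ge0.
Qed.

Lemma subset_weight_mean (R : realDomainType) (T : finType) (p m : R)
    (f : {set T} -> R) :
    0 <= p <= 1 -> m <= \sum_A subset_weight p A * f A ->
  exists A, m <= f A.
Proof.
move=> p01 le_m; case: (arg_maxP f (erefl : predT set0)) => A _ maxA.
exists A; apply: le_trans le_m _.
(* The case of an empty [S] says that the weights sum to 1, so the maximum of [f] is at least its
   mean. *)
have /esym := sum_subset_weight p (set0 : {set T}).
rewrite cards0 expr0 => sum1.
rewrite -[leRHS]mul1r sum1 mulr_suml; apply: ler_sum => B _.
rewrite sub0set mulr1 ler_wpM2l ?subset_weight_ge0 //; exact: maxA.
Qed.

(** * Dense subhypergraphs of the skeleton *)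

Lemma skeletal_degeneracyP (V : finType) (H : {set {set V}}) (i d : nat) :
    (0 < d)%N -> (d <= skeletal_degeneracy i H)%N ->
  exists W F, subhypergraph W F (skeleton i H) /\ (d <= min_degree W F)%N.
Proof.
move=> d_gt0; rewrite /skeletal_degeneracy; case: ex_minnP => m _ min_m le_dm.
(* By minimality of [m >= d] the bound [d.-1] fails, and a witness of its failure has minimum degree
   at least [d]. *)
have : ~~ degeneracy_le (skeleton i H) d.-1.
  by apply: contraL le_dm => /min_m; rewrite -ltnNge; case: d d_gt0.
case/forallPn=> W /forallPn[F]; rewrite negb_imply -ltnNge => /andP[sub].
by rewrite prednK //; exists W, F.
Qed.

Lemma min_degree_le (V : finType) (W : {set V}) (F : {set {set V}}) (v : V) :
  v \in W -> (min_degree W F <= degree F v)%N.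
Proof.
move=> vW; rewrite /min_degree; elim: (index_enum V) (mem_index_enum v) => //.
move=> u r IHr; rewrite inE big_cons => /predU1P[<- | /IHr le_r].
  by rewrite vW geq_minl.
by case: ifP => // _; rewrite geq_min le_r orbT.
Qed.

Lemma min_degree_card (V : finType) (W : {set V}) (F : {set {set V}}) :
  (min_degree W F <= #|F|)%N.
Proof.
rewrite /min_degree; elim/big_rec: _ => // v x _ lex.
by rewrite geq_min lex orbT.
Qed.

(** Count incidences between [X] and the edges meeting it: each such edge has at most [j] vertices
    in [X]. *)
Lemma degree_sum_le (V : finType) (F : {set {set V}}) (X : {set V})
    (j d : nat) :
    {in F, forall S : {set V}, #|S| = j} ->
    {in X, forall v, (d <= degree F v)%N} ->
  (d * #|X| <= j * #|[set S in F | ~~ [disjoint S & X]]|)%N.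
Proof.
move=> cardF degX; set Y := [set S in F | _].
apply: (@leq_trans (\sum_(v in X) \sum_(S in Y) (v \in S))%N).
  rewrite mulnC -sum_nat_const; apply: leq_sum => v vX.
  apply: leq_trans (degX v vX) _.
  rewrite -big_mkcondr /= sum1dep_card /degree; apply: subset_leq_card.
  apply/subsetP=> S; rewrite !inE => /andP[SF vS].
  by rewrite SF vS andbT; apply/pred0Pn; exists v; rewrite /= vS vX.
rewrite exchange_big /= mulnC -sum_nat_const; apply: leq_sum => S.
rewrite inE => /andP[SF _]; rewrite -big_mkcondr /= sum1dep_card -(cardF S SF).
by apply: subset_leq_card; apply/subsetP=> v; rewrite inE => /andP[].
Qed.

Lemma card_lt_verts (V : finType) (W : {set V}) (F : {set {set V}})
    (j k : nat) :
    {in F, forall S : {set V}, #|S| = j} ->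
    {in F, forall S : {set V}, S \subset W} ->
  ('C(k, j) < #|F|)%N -> (k < #|W|)%N.
Proof.
move=> cardF subF; apply: contraTT; rewrite -!leqNgt => leWk.
apply: leq_trans (leq_bin2l j leWk).
rewrite -cards_draws; apply: subset_leq_card; apply/subsetP=> S SF.
by rewrite inE subF //= cardF.
Qed.

(** * Images of embeddings relative to a fixed set *)

Definition draws (T : finType) (j : nat) (K : {set T}) : {set {set T}} :=
  [set S : {set T} | (S \subset K) && (#|S| == j)].

Definition images (V T : finType) (F : {set {set V}}) (g : V -> T) :
  {set {set T}} := [set g @: (S : {set V}) | S in F].

Section Embeddings.
Variables (R : realType) (V T : finType) (t0 : T) (W : {set V}) (K : {set T}).

(** Fixing the value [t0] off [W] makes each injection of [W] into [T] appear exactly once. *)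
Definition local_maps : {set {ffun V -> T}} :=
  [set g in pffun_on t0 W predT | dinjectiveb g W].

Lemma card_inside (g : {ffun V -> T}) : {in W &, injective g} ->
  (#|[set w in W | g w \in K]| <= #|K|)%N.
Proof.
move=> injg; rewrite -(@card_in_imset _ _ g); last first.
  by move=> u v; rewrite !inE => /andP[uW _] /andP[vW _]; apply: injg.
by apply: subset_leq_card; apply/subsetP=> _ /imsetP[w + ->];
  rewrite inE => /andP[].
Qed.

(* An injective map sends at most #|K| vertices into K, so each of these may be
   discounted by 1/y at the cost of a factor y ^ #|K|; the discounted sum is a
   product over W. *)
Lemma sum_outside_le (x y : R) : 0 <= x -> 1 <= y ->
  \sum_(g in local_maps) x ^+ #|[set w in W | g w \notin K]|
    <= y ^+ #|K| * (#|K|%:R / y + #|T|%:R * x) ^+ #|W|.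
Proof.
move=> x_ge0 y_ge1; have y_gt0 : 0 < y by apply: lt_le_trans y_ge1.
pose f (w : V) (t : T) : R := if t \in K then y^-1 else x.
have f_ge0 w t : 0 <= f w t.
  by rewrite /f; case: ifP => // _; rewrite invr_ge0 ltW.
have prod_const_in (P : pred V) (c : R) :
    \prod_(w in W | P w) c = c ^+ #|[set w in W | P w]|.
  by rewrite -prodr_const; apply: eq_bigl => w; rewrite inE.
apply: (@le_trans _ _ (y ^+ #|K| * \prod_(w in W) \sum_(t in predT) f w t)).
  rewrite (big_distr_big t0 (mem W) predT f) mulr_sumr.
  rewrite [X in _ <= X](bigID (fun g : {ffun V -> T} => dinjectiveb g W)) /=.
  apply: ler_wpDr.
    apply: sumr_ge0 => g _; rewrite mulr_ge0 ?exprn_ge0 ?(ltW y_gt0) //.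
    by apply: prodr_ge0.
  rewrite (eq_bigl _ _ (fun g => in_set _ g)).
  apply: ler_sum => g /andP[_ /dinjectiveP injg].
  rewrite (bigID (fun w => g w \in K)) /=.
  rewrite (eq_bigr (fun=> y^-1)) => [|w /andP[_ gwK]]; last by rewrite /f gwK.
  rewrite [X in _ * (_ * X)](eq_bigr (fun=> x)); last first.
    by move=> w /andP[_ /negPf gwK]; rewrite /f gwK.
  rewrite !prod_const_in.
  rewrite mulrA ler_peMl ?exprn_ge0 // exprVn ler_pdivlMr ?exprn_gt0 // mul1r.
  by rewrite ler_weXn2l ?card_inside.
apply: ler_wpM2l; first by rewrite exprn_ge0 ?(ltW y_gt0).
rewrite -prodr_const; apply: ler_prod => w _; rewrite sumr_ge0 //=.
rewrite (bigID (mem K)) /=; apply: lerD.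
  rewrite (eq_bigr (fun=> y^-1)) => [|t tK]; last by rewrite /f tK.
  by rewrite sumr_const mulr_natl.
rewrite (eq_bigr (fun=> x)) => [|t tK]; last by rewrite /f (negPf tK).
by rewrite sumr_const -[leLHS]mulr_natl ler_wpM2r // ler_nat max_card.
Qed.

Variables (F : {set {set V}}) (j d : nat).
Hypotheses (cardF : {in F, forall S : {set V}, #|S| = j})
  (subF : {in F, forall S : {set V}, S \subset W})
  (degF : {in W, forall v, (d <= degree F v)%N}).

Lemma imset_subset_inj (g : {ffun V -> T}) (S S' : {set V}) :
    {in W &, injective g} -> S \subset W -> S' \subset W ->
  g @: S \subset g @: S' -> S \subset S'.
Proof.
move=> injg /subsetP sSW /subsetP sSW' /subsetP sg; apply/subsetP=> v vS.
have /imsetP[u uS' eq_g] := sg _ (imset_f g vS).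
by rewrite (injg v u (sSW v vS) (sSW' u uS') eq_g).
Qed.

(** An image edge inside [K] is a [j]-subset of [K], hence already drawn; the other image edges are
    new, and distinct by injectivity. *)
Lemma card_draws_images (g : {ffun V -> T}) : {in W &, injective g} ->
  #|draws j K :|: images F g|
    = ('C(#|K|, j) + #|[set S in F | ~~ (g @: S \subset K)]|)%N.
Proof.
move=> injg; set Y := [set S in F | _].
have -> : draws j K :|: images F g
    = draws j K :|: [set g @: (S : {set V}) | S in Y].
  apply/setP=> S; rewrite !inE.
  have [//= | nKS /=] := boolP ((S \subset K) && (#|S| == j)).
  apply/imsetP/imsetP => -[U UF eS]; exists U => //; last first.
    by move: UF; rewrite inE => /andP[].
  rewrite inE UF /=; apply: contra nKS; rewrite -eS => -> /=.
  rewrite eS card_in_imset ?cardF //.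
  by move=> u v /(subsetP (subF UF)) uW /(subsetP (subF UF)) vW; apply: injg.
rewrite cardsU disjoint_setI0 ?cards0 ?subn0; last first.
  rewrite disjoint_sym; apply/pred0P => S /=; apply/negP.
  move=> /andP[/imsetP[U + ->]].
  by rewrite !inE => /andP[_ /negPf ->].
congr (_ + _)%N; first by rewrite cards_draws.
apply: card_in_imset => S S'; rewrite !inE => /andP[SF _] /andP[SF' _] eqg.
apply/eqP; rewrite eqEsubset; apply/andP.
by split; apply: (imset_subset_inj injg); rewrite ?subF // eqg.
Qed.

(** Every edge meeting the set of vertices sent outside [K] has its image not inside [K], so
    [degree_sum_le] applies to that set. *)
Lemma outside_degree (g : {ffun V -> T}) :
  (d * #|[set w in W | g w \notin K]|
     <= j * #|[set S in F | ~~ (g @: S \subset K)]|)%N.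
Proof.
set X := [set w in W | _].
apply: leq_trans (degree_sum_le (X := X) (d := d) cardF _) _.
  by move=> v; rewrite inE => /andP[vW _]; apply: degF.
rewrite leq_mul2l; apply/orP; right; apply: subset_leq_card.
apply/subsetP=> S; rewrite !inE => /andP[-> /=] /pred0Pn[v /= /andP[vS]].
rewrite inE => /andP[_]; apply: contra => /subsetP sgK.
by rewrite sgK ?imset_f.
Qed.

Lemma sum_draws_images_le (p x y : R) : (0 < d)%N ->
    0 <= p <= 1 -> 0 <= x <= 1 -> p ^+ d = x ^+ j -> 1 <= y ->
  \sum_(g in local_maps) p ^+ #|draws j K :|: images F g|
    <= p ^+ 'C(#|K|, j) * (y ^+ #|K| * (#|K|%:R / y + #|T|%:R * x) ^+ #|W|).
Proof.
move=> d_gt0 /andP[p_ge0 p_le1] /andP[x_ge0 x_le1] pdxj y_ge1.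
apply: le_trans (ler_wpM2l _ (sum_outside_le x_ge0 y_ge1)).
  rewrite mulr_sumr; apply: ler_sum => g.
  rewrite inE => /andP[_ /dinjectiveP injg].
  rewrite card_draws_images // exprD ler_wpM2l ?exprn_ge0 //.
  (* Compare [d]-th powers: with [m] new edges and [u] outside vertices, [p ^+ (d * m) = x ^+ (j *
     m) <= x ^+ (d * u)] by [outside_degree]. *)
  rewrite -(ler_pXn2r d_gt0) ?nnegrE ?exprn_ge0 // -exprM mulnC exprM pdxj.
  by rewrite -!exprM ler_wiXn2l // mulnC outside_degree.
by rewrite exprn_ge0.
Qed.
End Embeddings.

(** * Cliques of a random family and the first moment *)

Definition cliques (T : finType) (k j : nat) (A : {set {set T}}) :
  {set {set T}} := [set K : {set T} | (#|K| == k) && (draws j K \subset A)].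

Lemma cliques_avoiding (R : realType) (V T : finType) (t0 : T) (W : {set V})
    (F : {set {set V}}) (j k : nat) (p : R) :
    0 <= p <= 1 ->
    (forall K : {set T}, #|K| = k ->
       \sum_(g in local_maps t0 W) p ^+ #|draws j K :|: images F g|
         <= p ^+ 'C(k, j) / 2) ->
  exists A : {set {set T}}, 'C(#|T|, k)%:R * (p ^+ 'C(k, j) / 2)
    <= (if [exists g in local_maps t0 W, images F g \subset A] then 0
        else #|cliques k j A|%:R).
Proof.
move=> p01 boundK; apply: (subset_weight_mean p01).
(* Each clique counts 1, minus 1 for every embedding with image in [A]. So [f A] is at most 0 when
   an embedding exists, and is the number of cliques otherwise. *)
pose f (A : {set {set T}}) : R := \sum_(K : {set T} | #|K| == k)
  ((draws j K \subset A)%:R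
   - \sum_(g in local_maps t0 W) (draws j K :|: images F g \subset A)%:R).
apply: (@le_trans _ _ (\sum_A subset_weight p A * f A)).
  under eq_bigr do rewrite /f mulr_sumr.
  rewrite exchange_big /= -(card_draws T k) mulr_natl.
  rewrite -sumr_const (eq_bigl _ _ (fun K => in_set _ K)).
  apply: ler_sum => K /eqP cardK.
  under eq_bigr do rewrite mulrBr mulr_sumr.
  rewrite sumrB exchange_big /= sum_subset_weight cards_draws cardK.
  under eq_bigr do rewrite sum_subset_weight.
  rewrite lerBrDr [leRHS](splitr (p ^+ _)) lerD2l; exact: boundK.
apply: ler_sum => A _; rewrite ler_wpM2l ?subset_weight_ge0 //.
case: ifP => [/exists_inP[g gloc sgA] | _].
  apply: sumr_le0 => K _; rewrite subr_le0.
  have [sKA | _] := boolP (draws j K \subset A); last by apply: sumr_ge0.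
  rewrite (bigD1 g) //= subUset sKA sgA lerDl.
  by apply: sumr_ge0.
rewrite -sum1_card natr_sum (eq_bigl _ _ (fun K => in_set _ K)) big_mkcondr /=.
apply: ler_sum => K _; apply: (@le_trans _ _ (draws j K \subset A)%:R).
  by rewrite gerBl; apply: sumr_ge0.
by case: ifP.
Qed.

(** A copy of [H] among the cliques restricts to an embedding of [F] in [A]: each edge of [F] lies
    in an edge of [H], whose image is a clique. *)
Lemma ex_ge_cliques (V : finType) (n k i : nat) (t0 : 'I_n)
    (H F : {set {set V}}) (W : {set V}) (A : {set {set 'I_n}}) :
    subhypergraph W F (skeleton i H) ->
    ~~ [exists g in local_maps t0 W, images F g \subset A] ->
  (#|cliques k i.+1 A| <= ex k n H)%N.
Proof.
move=> /andP[/subsetP subFH /forall_inP subFW] noF.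
apply: bigop.leq_bigmax_cond; apply/andP; split.
  by apply/forall_inP => K; rewrite inE => /andP[].
apply: contra noF => /existsP[f /andP[/injectiveP injf /forall_inP fH]].
pose g := [ffun v => if v \in W then f v else t0].
have gW v : v \in W -> g v = f v by rewrite ffunE => ->.
apply/exists_inP; exists g.
  rewrite inE; apply/andP; split; last first.
    by apply/dinjectiveP => u v uW vW; rewrite !gW //; apply: injf.
  apply/pffun_onP; split=> //; apply/subsetP=> v; rewrite inE ffunE.
  by case: ifP => //; rewrite eqxx.
apply/subsetP=> _ /imsetP[S SF ->].
have /[!inE] /andP[/eqP cardS /exists_inP[e eH sSe]] := subFH S SF.
have -> : g @: S = f @: S.
  by apply: eq_in_imset => v vS; rewrite gW // (subsetP (subFW S SF)).
have /[!inE] /andP[_ /subsetP] := fH e eH; apply.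
by rewrite inE imsetS //= card_imset ?cardS.
Qed.

Lemma ex_ge (R : realType) (V : finType) (H : {set {set V}})
    (n k i d : nat) (p x y : R) :
    (0 < n)%N -> (0 < d)%N -> ('C(k, i.+1) < d)%N ->
    (d <= skeletal_degeneracy i H)%N ->
    0 <= p <= 1 -> 0 <= x <= 1 -> 1 <= y -> p ^+ d = x ^+ i.+1 ->
    k%:R / y + n%:R * x <= 1 ->
    y ^+ k * (k%:R / y + n%:R * x) ^+ k.+1 <= 2^-1 ->
  'C(n, k)%:R * p ^+ 'C(k, i.+1) / 2 <= (ex k n H)%:R.
Proof.
case: n => // n _ d_gt0 lt_bin le_d p01 x01 y_ge1 pdx s_le1 s_le.
have [W [F [subF le_deg]]] := skeletal_degeneracyP d_gt0 le_d.
have /andP[/subsetP subFH /forall_inP subFW] := subF.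
have cardF : {in F, forall S : {set V}, #|S| = i.+1}.
  by move=> S /subFH; rewrite inE => /andP[/eqP].
have degF : {in W, forall v, (d <= degree F v)%N}.
  by move=> v vW; apply: leq_trans le_deg (min_degree_le _ vW).
have lt_kW : (k < #|W|)%N.
  apply: card_lt_verts cardF subFW _; apply: leq_trans lt_bin _.
  by apply: leq_trans le_deg (min_degree_card _ _).
have s_ge0 : 0 <= k%:R / y + n.+1%:R * x.
  have y_ge0 := le_trans ler01 y_ge1; have /andP[x_ge0 _] := x01.
  by rewrite addr_ge0 ?mulr_ge0 ?invr_ge0.
have [|A] := @cliques_avoiding R V 'I_n.+1 ord0 W F i.+1 k p p01.
  move=> K cardK.
  have := sum_draws_images_le ord0 K cardF subFW degF d_gt0 p01 x01 pdx y_ge1.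
  move=> /le_trans; apply.
  have /andP[p_ge0 _] := p01.
  rewrite cardK card_ord ler_wpM2l ?exprn_ge0 //; apply: le_trans s_le.
  (* The base is at most 1 and [#|W| >= k.+1], so the exponent [#|W|] may be lowered to [k.+1]. *)
  by rewrite ler_wpM2l ?exprn_ge0 ?(le_trans ler01) // ler_wiXn2l.
rewrite card_ord mulrA => /le_trans; apply.
case: ifPn => [_ | noF]; first exact: ler0n.
by rewrite ler_nat (ex_ge_cliques _ subF noF).
Qed.

(** * Numerical estimates and choice of parameters *)

Lemma expn_le_ffact (n m : nat) :
  (2 * m <= n)%N -> (n ^ m <= 2 ^ m * n ^_ m)%N.
Proof.
elim: m => // m IHm le_mn.
have le_n : (n <= 2 * (n - m))%N.
  by rewrite mulnBr leq_subRL ?mul2n -?addnn ?leq_add2r; lia.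
have le_m : (2 * m <= n)%N by lia.
rewrite !expnSr ffactnSr mulnACA.
by apply: leq_mul; first exact: IHm.
Qed.

(** One term of the expansion of [(1 + 2) ^ k] is ['C(k, j) * 2 ^ j], and [j < 2 ^ j]. *)
Lemma mul_bin_le (k j : nat) : (j * 'C(k, j) <= 3 ^ k)%N.
Proof.
have [lt_kj | le_jk] := ltnP k j; first by rewrite bin_small ?muln0.
rewrite (expnDn 1 2) (bigD1 (inord j)) //= inordK // exp1n mul1n mulnC.
by apply: leq_trans (leq_addr _ _); rewrite leq_mul2l ltnW ?orbT // ltn_expl.
Qed.

Theorem theorem3p2 (R : realType) (k : nat) (k_gt0 : (0 < k)%N) :
  exists c : R, 0 < c /\ exists N : nat,
    forall (d i : nat) (V : finType) (H : {set {set V}}),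
      (0 < d)%N -> (1 <= i)%N -> (i < k)%N -> ('C(k, i.+1) < d)%N ->
      uniform k H -> (d <= skeletal_degeneracy i H)%N ->
      forall n : nat, (N <= n)%N ->
        c * n%:R `^ (k%:R - 3 ^+ k / d%:R) <= (ex k n H)%:R.
Proof.
(* [q] is chosen so that [a ^+ k * (2 * q) = 1/2], which is the final smallness condition once
   [y * (2 * q) = a]. *)
pose a : R := 2 * k%:R; pose q : R := (4 * a ^+ k)^-1.
have k_ge1 : 1 <= k%:R :> R by rewrite ler1n.
have a_ge1 : 1 <= a by rewrite /a; lra.
have ak_ge1 : 1 <= a ^+ k by apply: exprn_ege1.
have ak_gt0 : 0 < a ^+ k by apply: lt_le_trans ak_ge1.
have q_gt0 : 0 < q by rewrite invr_gt0 mulr_gt0.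
have q_le : q <= 4^-1 by rewrite lef_pV2 ?posrE; lra.
have q_le1 : q <= 1 by lra.
pose B : R := 2 * 2 ^+ k * k`!%:R.
have B_gt0 : 0 < B by rewrite !mulr_gt0 ?exprn_gt0 ?ltr0n ?fact_gt0.
(* [B] collects the loss [2 ^+ k * k!] from the binomial and the factor 2 from halving;
   [q ^+ (3 ^ k)] bounds [q] to the power [3 ^ k / d] uniformly in [d >= 1]. *)
exists (q ^+ (3 ^ k) / B); split; first by rewrite divr_gt0 ?exprn_gt0.
exists (2 * k)%N => d i V H d_gt0 _ _ lt_bin _ le_d n le_n.
have n_gt0 : (0 < n)%N by lia.
have n_ge1 : 1 <= n%:R :> R by rewrite ler1n.
have nR_gt0 : 0 < n%:R :> R by rewrite ltr0n.
have dR_ge1 : 1 <= d%:R :> R by rewrite ler1n.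
have dR_gt0 : 0 < d%:R :> R by rewrite ltr0n.
pose x : R := q / n%:R; pose p : R := x `^ (i.+1%:R / d%:R).
have x_gt0 : 0 < x by rewrite divr_gt0.
have x_le1 : x <= 1 by rewrite ler_pdivrMr // mul1r; lra.
have x01 : 0 < x <= 1 by rewrite x_gt0.
(* This choice balances the two terms: k / y = n x = q. *)
pose y : R := k%:R / q.
have y_ge1 : 1 <= y by rewrite ler_pdivlMr // mul1r; lra.
have s_eq : k%:R / y + n%:R * x = 2 * q.
  by rewrite /y /x; field; rewrite !gt_eqF //; lra.
have p01 : 0 <= p <= 1.
  rewrite powR_ge0 -(powRr0 x) ger_powR //= divr_ge0 //.
have pdx : p ^+ d = x ^+ i.+1.
  rewrite -powR_mulrn ?powR_ge0 // -powRrM divfK ?gt_eqF //.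
  by rewrite powR_mulrn // ltW.
apply: le_trans (ex_ge (x := x) (y := y) n_gt0 d_gt0 lt_bin le_d p01 _ y_ge1
                       pdx _ _).
(* [p ^+ 'C(k, i.+1)] is [x] to the power [(i.+1) * 'C(k, i.+1) / d]; as [x <= 1], raising the
   exponent to [3 ^ k / d] only decreases it. *)
- have pC : q ^+ (3 ^ k) * n%:R `^ (- (3 ^+ k / d%:R)) <= p ^+ 'C(k, i.+1).
    rewrite -[leRHS]powR_mulrn ?powR_ge0 // -[leRHS]powRrM.
    apply: (@le_trans _ _ (x `^ (3 ^+ k / d%:R))); last first.
      rewrite ger_powR // mulrAC ler_wpM2r ?invr_ge0 // -natrM -natrX ler_nat.
      exact: mul_bin_le.
    rewrite powRM ?(ltW q_gt0) ?invr_ge0 //.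
    rewrite -[n%:R^-1 in leRHS]powR_inv1 // -[in leRHS]powRrM mulN1r.
    rewrite ler_wpM2r ?powR_ge0 // -[leLHS]powR_mulrn ?(ltW q_gt0) //.
    rewrite ger_powR ?q_gt0 ?q_le1 //.
    by rewrite natrX ler_pdivrMr // ler_peMr // exprn_ge0.
  have binE : n%:R ^+ k / (2 ^+ k * k`!%:R) <= 'C(n, k)%:R :> R.
    rewrite ler_pdivrMr ?mulr_gt0 ?exprn_gt0 ?ltr0n ?fact_gt0 // mulrCA.
    by rewrite -natrM bin_ffact -!natrX -natrM ler_nat expn_le_ffact.
  rewrite powRD; last by apply/implyP=> _; rewrite gt_eqF.
  rewrite powR_mulrn // ler_pdivlMr //.
  set z := _ `^ _ in pC *; set u := q ^+ _ in pC *.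
  have -> : u / B * (n%:R ^+ k * z) * 2
      = n%:R ^+ k / (2 ^+ k * k`!%:R) * (u * z).
    by rewrite /B; field; rewrite !gt_eqF ?exprn_gt0 ?ltr0n ?fact_gt0.
  apply: ler_pM => //.
    by rewrite divr_ge0 ?mulr_ge0 ?exprn_ge0.
  by rewrite mulr_ge0 ?powR_ge0 ?exprn_ge0 ?ltW.
- by rewrite ltW.
- by rewrite s_eq; lra.
- have yq : y * (2 * q) = a by rewrite /y /a; field; rewrite gt_eqF.
  rewrite s_eq exprSr mulrA -exprMn yq.
  suff -> : a ^+ k * (2 * q) = 2^-1 by [].
  by rewrite /q; field; rewrite gt_eqF.
Qed.
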